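(* Let $\mathbb{K}=\mathbb{R}$ or $\mathbb{K}=\mathbb{C}$, and let $\mu\le\mathrm{PSL}_2(\mathbb{K})$ be a maximal abelian subgroup. Define $\phi\colon\mu\to\mathrm{PSL}_2(\mathbb{K})$ by $$\phi(\nu)=g_1\nu^{m_1}g_2\nu^{m_2}\cdots g_k\nu^{m_k},$$ such that $k\ge1$ and such that for each $i=1,\ldots,k$ we have (i) $g_i\in\mathrm{PSL}_2(\mathbb{K})$ and $m_i\in\mathbb{Z}\setminus\{0\}$; (ii) $\mathrm{Fix}\,\mu\cap g_i\,\mathrm{Fix}\,\mu=\varnothing$. Then: (1) For each $x\in\mathbb{K}$ the set $\{\nu\in\mu : \mathrm{tr}^2\circ\phi(\nu)=x\}$ is finite. (2) If $\mu$ is not purely elliptic, then $$\lim_{\|\nu\|\to\infty,\ \nu\in\mu}|\mathrm{tr}\circ\phi(\nu)|=\infty.$$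
   Context: $\mathrm{PSL}_2(\mathbb{R})=\mathrm{Isom}^+(\mathbb{H}^2)$ and $\mathrm{PSL}_2(\mathbb{C})=\mathrm{Isom}^+(\mathbb{H}^3)$; let $d=2$ for $\mathbb{K}=\mathbb{R}$ and $d=3$ for $\mathbb{K}=\mathbb{C}$. $\mathrm{Fix}\,\mu$ is the set of points of $\mathbb{H}^d\cup\partial\mathbb{H}^d$ fixed by all elements of $\mu$. $\|\nu\|$ is the $\ell^2$-norm of a matrix representing $\nu$. The quantities $\mathrm{tr}^2$ and $|\mathrm{tr}|$ are well defined on $\mathrm{PSL}_2(\mathbb{K})$. The case excluded in (2) is that $\mu$ consists entirely of elliptic elements, i.e. $\mu$ is conjugate to $\mathrm{SO}(2)$ in $\mathrm{PSL}_2(\mathbb{R})$. *)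

(* Defs.v *)
From HB Require Import structures.
From mathcomp Require Import all_boot all_order all_algebra.
From mathcomp Require Import generic_quotient.
From mathcomp Require Import complex.
From mathcomp Require Import all_classical all_reals all_analysis.

Set Implicit Arguments.
Unset Strict Implicit.
Unset Printing Implicit Defensive.

Import Order.TTheory GRing.Theory Num.Theory.
Import numFieldNormedType.Exports.

Local Open Scope quotient_scope.
Local Open Scope classical_set_scope.
Local Open Scope ring_scope.

Definition SL2 (K : fieldType) : Type := {A : 'M[K]_2 | \det A == 1}.

HB.instance Definition _ (K : fieldType) :=
  SubType.copy (SL2 K) {A : 'M[K]_2 | \det A == 1}.
HB.instance Definition _ (K : fieldType) :=
  Choice.copy (SL2 K) {A : 'M[K]_2 | \det A == 1}.

Section SL2Group.
Variable K : fieldType.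
Implicit Types A B : SL2 K.

Lemma SL2_det A : \det (val A) = 1. Proof. exact/eqP/(valP A). Qed.

Lemma SL2_unit A : val A \in unitmx.
Proof. by rewrite unitmxE SL2_det unitr1. Qed.

Fact SL2_one_subproof : \det (1%:M : 'M[K]_2) == 1.
Proof. by rewrite det1. Qed.
Fact SL2_mul_subproof A B : \det (val A *m val B) == 1.
Proof. by rewrite det_mulmx !SL2_det mulr1. Qed.
Fact SL2_inv_subproof A : \det (invmx (val A)) == 1.
Proof. by rewrite det_inv SL2_det invr1. Qed.
Fact SL2_opp_subproof A : \det (- val A) == 1.
Proof. by rewrite -scaleN1r detZ sqrrN expr1n mul1r SL2_det. Qed.

Definition SL2_one : SL2 K := Sub 1%:M SL2_one_subproof.
Definition SL2_mul A B : SL2 K := Sub (val A *m val B) (SL2_mul_subproof A B).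
Definition SL2_inv A : SL2 K := Sub (invmx (val A)) (SL2_inv_subproof A).
Definition SL2_opp A : SL2 K := Sub (- val A) (SL2_opp_subproof A).

Fact SL2_mulA : associative SL2_mul.
Proof. by move=> A B C; apply: val_inj; rewrite !SubK mulmxA. Qed.
Fact SL2_mul1 : left_id SL2_one SL2_mul.
Proof. by move=> A; apply: val_inj; rewrite !SubK mul1mx. Qed.
Fact SL2_mulr1 : right_id SL2_one SL2_mul.
Proof. by move=> A; apply: val_inj; rewrite !SubK mulmx1. Qed.
Fact SL2_mulV : left_inverse SL2_one SL2_inv SL2_mul.
Proof. by move=> A; apply: val_inj; rewrite !SubK mulVmx ?SL2_unit. Qed.
Fact SL2_mulrV : right_inverse SL2_one SL2_inv SL2_mul.
Proof. by move=> A; apply: val_inj; rewrite !SubK mulmxV ?SL2_unit. Qed.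

HB.instance Definition _ := isGroup.Build (SL2 K)
  SL2_mulA SL2_mul1 SL2_mulr1 SL2_mulV SL2_mulrV.

Definition PSL2_rel A B := (val A == val B) || (val A == - val B).

Fact PSL2_rel_refl : reflexive PSL2_rel.
Proof. by move=> A; rewrite /PSL2_rel eqxx. Qed.
Fact PSL2_rel_sym : symmetric PSL2_rel.
Proof.
by move=> A B; rewrite /PSL2_rel eq_sym [X in _ || X]eq_sym eqr_oppLR.
Qed.
Fact PSL2_rel_trans : transitive PSL2_rel.
Proof.
move=> B A C /orP[] /eqP AB /orP[] /eqP BC;
  by rewrite /PSL2_rel AB BC ?opprK eqxx ?orbT.
Qed.

Canonical PSL2_equiv :=
  EquivRel PSL2_rel PSL2_rel_refl PSL2_rel_sym PSL2_rel_trans.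

End SL2Group.

Definition PSL2 (K : fieldType) : Type := {eq_quot (@PSL2_rel K)}.

HB.instance Definition _ (K : fieldType) := Choice.on (PSL2 K).
HB.instance Definition _ (K : fieldType) := EqQuotient.on (PSL2 K).

Section PSL2Group.
Variable K : fieldType.
Implicit Types p q r : PSL2 K.

Lemma PSL2_eqP (A B : SL2 K) :
  reflect (val A = val B \/ val A = - val B) (\pi_(PSL2 K) A == \pi_(PSL2 K) B).
Proof.
rewrite eqmodE; apply: (iffP orP) => -[] /eqP h.
- by left.
- by right.
- by left.
- by right.
Qed.

Lemma PSL2_reprP (A : SL2 K) :
  val (repr (\pi_(PSL2 K) A)) = val A \/ val (repr (\pi_(PSL2 K) A)) = - val A.
Proof. by apply/PSL2_eqP; rewrite reprK. Qed.

Definition PSL2_one : PSL2 K := \pi_(PSL2 K) 1%g.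
Definition PSL2_mul p q : PSL2 K := \pi_(PSL2 K) (repr p * repr q)%g.
Definition PSL2_inv p : PSL2 K := \pi_(PSL2 K) (repr p)^-1%g.

Lemma PSL2_piM (A B : SL2 K) :
  \pi_(PSL2 K) (A * B)%g = PSL2_mul (\pi A) (\pi B).
Proof.
apply/eqP/PSL2_eqP => /=.
by case: (PSL2_reprP A) => ->; case: (PSL2_reprP B) => ->;
  rewrite ?mulmxN ?mulNmx ?opprK; [left|right|right|left].
Qed.

Lemma PSL2_piV (A : SL2 K) : \pi_(PSL2 K) (A^-1)%g = PSL2_inv (\pi A).
Proof.
apply/eqP/PSL2_eqP => /=.
case: (PSL2_reprP A) => ->; [by left | right].
have uA : -1 *: val A \in unitmx by rewrite unitmxZ ?SL2_unit// unitrN1.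
by rewrite -(scaleN1r (val A)) (invmxZ uA) invrN1 scaleN1r opprK.
Qed.

Fact PSL2_mulA : associative PSL2_mul.
Proof.
by move=> p q r; rewrite -(reprK p) -(reprK q) -(reprK r) -!PSL2_piM mulgA.
Qed.
Fact PSL2_mul1 : left_id PSL2_one PSL2_mul.
Proof. by move=> p; rewrite -(reprK p) -PSL2_piM mul1g. Qed.
Fact PSL2_mulr1 : right_id PSL2_one PSL2_mul.
Proof. by move=> p; rewrite -(reprK p) -PSL2_piM mulg1. Qed.
Fact PSL2_mulV : left_inverse PSL2_one PSL2_inv PSL2_mul.
Proof. by move=> p; rewrite -(reprK p) -PSL2_piV -PSL2_piM mulVg. Qed.
Fact PSL2_mulrV : right_inverse PSL2_one PSL2_inv PSL2_mul.
Proof. by move=> p; rewrite -(reprK p) -PSL2_piV -PSL2_piM mulgV. Qed.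

HB.instance Definition _ := isGroup.Build (PSL2 K)
  PSL2_mulA PSL2_mul1 PSL2_mulr1 PSL2_mulV PSL2_mulrV.

Definition PSL2_tr2 p : K := (\tr (val (repr p))) ^+ 2.

Lemma PSL2_tr2_pi (A : SL2 K) : PSL2_tr2 (\pi A) = (\tr (val A)) ^+ 2.
Proof.
by rewrite /PSL2_tr2; case: (PSL2_reprP A) => -> //; rewrite raddfN sqrrN.
Qed.

End PSL2Group.

Definition zexpg (G : groupType) (x : G) (m : int) : G :=
  match m with Posz n => x ^+ n | Negz n => x ^- n.+1 end%g.

Section AbelianSubgroups.
Variable G : groupType.
Implicit Types H L : set G.

Definition is_subgroup H : Prop :=
  H 1%g /\ forall x y, H x -> H y -> H (x / y)%g.

Definition is_abelian_subgroup H : Prop :=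
  is_subgroup H /\ forall x y, H x -> H y -> commute x y.

Definition is_maximal_abelian H : Prop :=
  is_abelian_subgroup H /\
  forall L, is_abelian_subgroup L -> H `<=` L -> L = H.

End AbelianSubgroups.

(* What is needed of K = R or C: conjugation, the real-valued modulus and the
   embedding of R. *)
Record scalars (R : realType) := Scalars {
  carrier :> numFieldType;
  conjK : carrier -> carrier;
  absK : carrier -> R;
  ofR : R -> carrier
}.

Definition real_scalars (R : realType) : scalars R :=
  @Scalars R R id Num.norm id.

Definition complex_scalars (R : realType) : scalars R :=
  @Scalars R R[i] (@conjc R) (@Normc.normc R) (real_complex R).

Section HyperbolicSpace.
Variables (R : realType) (K : scalars R).

(* Upper half-space model: [Some (z, t)] with t > 0 is a point of
   H^d = K * ]0, +oo[ (d = 2 if K = R, d = 3 if K = C), and the boundary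
   K \cup {oo} consists of the points [Some (z, 0)] and of [None] = oo. *)
Definition hpoint : Type := option (K * {nonneg R}).

Definition interior_point (x : hpoint) : Prop :=
  if x is Some (_, t) then 0 < t%:num else False.

Definition boundary_point (z : K) : hpoint := Some (z, 0%:nng).

Definition mob_den (c d z : K) (t : R) : R :=
  absK (c * z + d) ^+ 2 + absK c ^+ 2 * t ^+ 2.

Lemma mob_den_ge0 c d z t : 0 <= mob_den c d z t.
Proof. by apply: addr_ge0; [|apply: mulr_ge0]; exact: sqr_ge0. Qed.

Definition mob_height (c d z : K) (t : {nonneg R}) : {nonneg R} :=
  NngNum (divr_ge0 (ge0 t) (mob_den_ge0 c d z t%:num)).

(* Poincare extension of z |-> (a z + b) / (c z + d). For K = R this is the
   real-coordinate form of w |-> (a w + b) / (c w + d) at w = z + i t; for t = 0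
   it is the Moebius action on the projective line. *)
Definition SL2_act (A : SL2 K) (x : hpoint) : hpoint :=
  let a := val A 0 0 in let b := val A 0 1 in
  let c := val A 1 0 in let d := val A 1 1 in
  match x with
  | None => if c == 0 then None else boundary_point (a / c)
  | Some (z, t) =>
      let n := mob_den c d z t%:num in
      if n == 0 then None else
      Some (((a * z + b) * conjK (c * z + d)
             + a * conjK c * ofR K (t%:num ^+ 2)) / ofR K n,
            mob_height c d z t)
  end.

Definition PSL2_act (p : PSL2 K) (x : hpoint) : hpoint := SL2_act (repr p) x.

Definition Fix (mu : set (PSL2 K)) : set hpoint :=
  [set x | forall nu, mu nu -> PSL2_act nu x = x].

Definition elliptic (p : PSL2 K) : Prop :=
  p <> 1%g /\ exists x, interior_point x /\ PSL2_act p x = x.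

Definition purely_elliptic (mu : set (PSL2 K)) : Prop :=
  forall nu, mu nu -> nu <> 1%g -> elliptic nu.

Definition PSL2_abs_tr (p : PSL2 K) : R := absK (\tr (val (repr p))).

Definition PSL2_norm (p : PSL2 K) : R :=
  Num.sqrt (\sum_(i < 2) \sum_(j < 2) absK (val (repr p) i j) ^+ 2).

(* The filter "||nu|| -> oo with nu in mu" *)
Definition norm_to_oo (mu : set (PSL2 K)) : set_system (PSL2 K) :=
  [set A | exists M : R, forall nu, mu nu -> M < PSL2_norm nu -> A nu].

Definition phi (k : nat) (g : 'I_k -> PSL2 K) (m : 'I_k -> int)
    (nu : PSL2 K) : PSL2 K :=
  (\prod_(i < k) (g i * zexpg nu (m i)))%g.

End HyperbolicSpace.

(* The notions above do not depend on the representing matrix. *)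
Section WellDefined.
Variables (R : realType) (K : scalars R).
Hypothesis hK : K = real_scalars R \/ K = complex_scalars R.
Implicit Types (A : SL2 K) (p : PSL2 K).

Lemma absKN (x : K) : absK (- x) = absK x.
Proof. by case: hK x => -> x /=; [exact: normrN | exact: normcN]. Qed.

Lemma conjKN (x : K) : conjK (- x) = - conjK x.
Proof. by case: hK x => -> x //=; rewrite raddfN. Qed.

Lemma PSL2_abs_tr_pi A : PSL2_abs_tr (\pi_(PSL2 K) A) = absK (\tr (val A)).
Proof.
by rewrite /PSL2_abs_tr; case: (PSL2_reprP A) => -> //; rewrite raddfN absKN.
Qed.

Lemma PSL2_norm_pi A : PSL2_norm (\pi_(PSL2 K) A) =
  Num.sqrt (\sum_(i < 2) \sum_(j < 2) absK (val A i j) ^+ 2).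
Proof.
rewrite /PSL2_norm; case: (PSL2_reprP A) => -> //.
by congr Num.sqrt; apply: eq_bigr => i _; apply: eq_bigr => j _;
  rewrite mxE absKN.
Qed.

Lemma PSL2_act_pi A x : PSL2_act (\pi_(PSL2 K) A) x = SL2_act A x.
Proof.
rewrite /PSL2_act; set B := repr _.
have [EB|EB] : val B = val A \/ val B = - val A by exact: PSL2_reprP.
  by congr SL2_act; exact: val_inj.
have den (c d z : K) t : mob_den (- c) (- d) z t = mob_den c d z t :> R.
  by rewrite /mob_den mulNr -opprD !absKN.
rewrite /SL2_act EB !mxE; case: x => [[z t]|]; last first.
  by rewrite oppr_eq0 invrN mulrNN.
rewrite den; case: ifP => // _; congr (Some (_, _)).
  by rewrite !mulNr -!opprD !conjKN !(mulNr, mulrN) !opprK.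
by apply/eqP; rewrite -num_eq /= den.
Qed.

End WellDefined.

(* Main.v *)
Require Import Defs.
From mathcomp Require Import all_boot all_order all_algebra.
From mathcomp Require Import generic_quotient.
From mathcomp Require Import complex.
From mathcomp Require Import all_classical all_reals all_analysis.
From mathcomp Require Import zify ring lra.

Import Order.TTheory GRing.Theory Num.Theory.
Import numFieldNormedType.Exports.

Local Open Scope quotient_scope.
Local Open Scope classical_set_scope.
Local Open Scope ring_scope.

Set Implicit Arguments.
Unset Strict Implicit.
Unset Printing Implicit Defensive.

(** Unless mu is finite, a conjugation over K (over C if mu consists of rotations
    of the hyperbolic plane) brings mu either into the diagonal torus diag(t, 1/t) or
    into the unipotent group (1 s; 0 1). In the conjugated coordinates the trace of
    the word g_1 nu^m_1 ... g_k nu^m_k is a Laurent polynomial in t, respectively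
    a polynomial in s, and everything follows once its extreme term is known.

    In the torus, nu^m = diag(t^m, t^-m) is t^|m| times a rank one matrix, up to
    lower order: the projection on the first or on the second axis, according to
    the sign of m. A product of such leading terms is a product of entries of
    the g_i, so the trace is t^N, with N the sum of the |m_i|, times a product
    of entries of the g_i, up to lower order ([dominant], [torus_grows]). That
    Fix mu and g_i Fix mu are disjoint means that g_i carries no coordinate axis
    to a coordinate axis, that is, that no entry of g_i vanishes. In the
    unipotent group the leading term of g_i nu^m_i is m_i s times the first
    column of g_i, moved to the second one; the trace has leading term s^k times
    the product of the m_i and of the lower left entries of the g_i, and these
    do not vanish because g_i moves the axis fixed by mu ([unip_grows]).

    A Laurent polynomial with a term of positive degree takes the values +y and
    -y only finitely often ([finite_fibre]) and tends to infinity with its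
    argument ([poly_growth]). A large norm of nu means that s is large, or that t
    or 1/t is; exchanging the two axes turns 1/t into t.

    To find the coordinates, pick nu0 in mu, nu0 <> 1, with nonzero trace.
    Matrices that commute in PSL_2 commute up to sign, and the sign is + because
    an anticommuting pair is traceless; so mu lifts to the centralizer of a
    single matrix A0, which is the torus, the unipotent group up to sign, or, for
    K = R and tr^2 A0 < 4, the stabilizer of a point of the half-plane. In that
    last case mu is purely elliptic, and A0 becomes diagonal over C. If there is
    no such nu0, then any two distinct nontrivial elements of mu are involutions
    with anticommuting lifts, and mu is trivial, cyclic of order 2 or a Klein
    four-group ([finite_trace_zero]). *)

(** * Two by two matrices of polynomials with a dominant column *)

Lemma sum_ord2 (V : nmodType) (f : 'I_2 -> V) : \sum_i f i = f 0 + f 1.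
Proof.
by rewrite !big_ord_recl big_ord0 addr0; congr (_ + f _); apply: val_inj.
Qed.

Variant ord2_spec : 'I_2 -> Type := Ord2_0 : ord2_spec 0 | Ord2_1 : ord2_spec 1.

Lemma ord2P i : ord2_spec i.
Proof.
case: i => -[|[|//]] lt_i.
  by rewrite (_ : Ordinal _ = 0); [left | apply: val_inj].
by rewrite (_ : Ordinal _ = 1); [right | apply: val_inj].
Qed.

Section DominantColumn.
Variable F : fieldType.

Lemma coefM_top (p q : {poly F}) n n' :
  (size p <= n.+1)%N -> (size q <= n'.+1)%N -> (p * q)`_(n + n') = p`_n * q`_n'.
Proof.
move=> sp sq; have n_lt : (n < (n + n').+1)%N by rewrite ltnS leq_addr.
rewrite coefM (bigD1 (Ordinal n_lt)) //= addKn big1 ?addr0 // => j jn.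
have [jn'|nj] := ltnP j n.
  rewrite [q`_ _]nth_default ?mulr0 //; apply: leq_trans sq _.
  by move: jn'; clear; lia.
rewrite [p`_ _]nth_default ?mul0r //; apply: leq_trans sp _.
by rewrite ltn_neqAle nj andbT eq_sym.
Qed.

Lemma size_mul_top (p q : {poly F}) n n' :
  (size p <= n.+1)%N -> (size q <= n'.+1)%N -> (size (p * q)%R <= (n + n').+1)%N.
Proof.
move=> sp sq; apply: (leq_trans (size_polyMleq _ _)).
by lia.
Qed.

(** The matrix of coefficients of ['X^n] has a single nonzero column [b], whose
    entries are nonzero at the rows in [S]. As [b] lies itself in [S], the leading
    terms of two such matrices never cancel in a product. *)
Definition dominant (S : pred 'I_2) (n : nat) (M : 'M[{poly F}]_2) : Prop :=
  (forall r c, (size (M r c) <= n.+1)%N) /\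
  exists2 b, S b & forall r c,
    (c != b -> (M r c)`_n = 0) /\ (S r -> (M r b)`_n != 0).

(** In [\sum_j M r j * M' j c] only [j = b] contributes to the leading
    coefficient, and [M' b b'] has full degree because [S b] holds. *)
Lemma dominantM S n n' M M' :
  dominant S n M -> dominant S n' M' -> dominant S (n + n') (M * M').
Proof.
move=> [sM [b Sb Mb]] [sM' [b' Sb' Mb']]; split=> [r c|].
  rewrite !mxE (leq_trans (size_sum _ _ _))//; apply/bigmax_leqP => j _.
  exact: size_mul_top.
exists b' => // r c.
have E c' : ((M * M') r c')`_(n + n') = (M r b)`_n * (M' b c')`_n'.
  rewrite !mxE coef_sum (bigD1 b) //= coefM_top // big1 ?addr0 // => j jb.
  by rewrite coefM_top // (proj1 (Mb r j)) ?mul0r.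
rewrite !E; split=> [cb'|Sr]; first by rewrite (proj1 (Mb' b c)) ?mulr0.
by rewrite mulf_neq0 ?(proj2 (Mb r c)) ?(proj2 (Mb' b c)).
Qed.

Lemma dominant_prod S k (n : 'I_k -> nat) (M : 'I_k -> 'M[{poly F}]_2) :
  (0 < k)%N -> (forall i, dominant S (n i) (M i)) ->
  dominant S (\sum_i n i) (\prod_i M i).
Proof.
case: k n M => // k + + _; elim: k => [|k IH] n M dM.
  by rewrite !big_ord1.
by rewrite big_ord_recl [X in dominant _ _ X]big_ord_recl; apply/dominantM/IH.
Qed.

(** The only diagonal entry of full degree is the one in the dominant column. *)
Lemma dominant_tr S n M : dominant S n M -> size (\tr M) = n.+1.
Proof.
move=> [sM [b Sb Mb]]; apply/eqP; rewrite eqn_leq; apply/andP; split.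
  by rewrite (leq_trans (size_sum _ _ _))//; apply/bigmax_leqP.
rewrite ltnNge; apply/negP => /(nth_default 0).
rewrite coef_sum (bigD1 b) //= big1 ?addr0; last by move=> j /(proj1 (Mb j j)).
by apply/eqP/(proj2 (Mb b b)).
Qed.

End DominantColumn.

(** * The diagonal torus and the unipotent group *)

Section NormalForms.
Variable F : fieldType.

Definition torus (t : F) : 'M[F]_2 :=
  diag_mx (\row_j if j == 0 then t else t^-1).
Definition unip (s : F) : 'M[F]_2 := 1 + s *: delta_mx 0 1.

Lemma torusV (t : F) : t != 0 -> torus t * torus t^-1 = 1.
Proof.
move=> t0; rewrite /torus -mulmxE mulmx_diag; apply/matrixP => i j.
by rewrite !mxE; case: ifP => _; rewrite divff ?invr_eq0.
Qed.

Lemma torus_unit (t : F) : t != 0 -> torus t \is a GRing.unit.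
Proof.
move=> t0; apply/unitrP; exists (torus t^-1).
by rewrite -{2}[t]invrK !torusV ?invr_eq0.
Qed.

Lemma torusXz (t : F) (m : int) : t != 0 -> torus t ^ m = torus (t ^ m).
Proof.
move=> t0.
have E n : torus t ^+ n = torus (t ^+ n).
  elim: n => [|n IH].
    by rewrite !expr0; apply/matrixP => i j; rewrite !mxE invr1 if_same.
  rewrite exprS IH /torus -mulmxE mulmx_diag; congr diag_mx.
  by apply/rowP => j; rewrite !mxE; case: ifP; rewrite exprS // invfM.
case: m => n; first exact: E.
rewrite -[LHS]/((torus t ^+ n.+1)^-1) -[t ^ _]/((t ^+ n.+1)^-1) E.
have u0 : t ^+ n.+1 != 0 by rewrite expf_neq0.
by apply: (mulrI (torus_unit u0)); rewrite mulrV ?torus_unit // torusV.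
Qed.

Lemma unipD s s' : unip s * unip s' = unip (s + s').
Proof.
rewrite /unip mulrDl mul1r mulrDr mulr1 -mulmxE -scalemxAl -scalemxAr.
by rewrite mul_delta_mx_0 // !scaler0 addr0 scalerDl -addrA [X in 1 + X]addrC.
Qed.

Lemma unip_unit s : unip s \is a GRing.unit.
Proof.
by apply/unitrP; exists (unip (- s)); rewrite !unipD subrr addNr /unip scale0r addr0.
Qed.

Lemma unipXz (s : F) (m : int) : unip s ^ m = unip (m%:~R * s).
Proof.
have E n : unip s ^+ n = unip (n%:R * s).
  elim: n => [|n IH]; first by rewrite expr0 mul0r /unip scale0r addr0.
  by rewrite exprS IH unipD -natr1 mulrDl mul1r addrC.
case: m => n; first exact: E.
rewrite -[LHS]/((unip s ^+ n.+1)^-1) E NegzE; set u := _ * s.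
apply: (mulrI (unip_unit u)); rewrite mulrV ?unip_unit// unipD /u.
by rewrite rmorphN mulNr subrr /unip scale0r addr0.
Qed.

End NormalForms.

(** * The trace of a word as a polynomial *)

Section TracePolynomial.
Variable F : fieldType.

Definition word k (G : 'I_k -> 'M[F]_2) (m : 'I_k -> int) (X : 'M[F]_2) :
  'M[F]_2 := \prod_i (G i * X ^ m i).

Definition eval_mx (t : F) : 'M[{poly F}]_2 -> 'M[F]_2 :=
  map_mx (horner_eval t).

Lemma horner_tr_prod k (n : 'I_k -> nat) (M : 'I_k -> 'M[{poly F}]_2)
    (Y : 'I_k -> 'M[F]_2) (t : F) :
  (forall i, eval_mx t (M i) = t ^+ n i *: Y i) ->
  t ^+ (\sum_i n i) * \tr (\prod_i Y i) = (\tr (\prod_i M i)).[t].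
Proof.
move=> MY; have -> : t ^+ (\sum_i n i) = \prod_i t ^+ n i.
  exact: (big_morph _ (exprD t) (expr0 t)).
have E : eval_mx t (\prod_i M i) = \prod_i (t ^+ n i *: Y i).
  rewrite [LHS](rmorph_prod (map_mx (horner_eval t))).
  by apply: eq_bigr => i _; exact: MY.
by rewrite -[RHS]/(horner_eval t _) -trace_map_mx [map_mx _ _]E scaler_prod mxtraceZ.
Qed.

Lemma eval_mxC t (G : 'M[F]_2) : eval_mx t (map_mx polyC G) = G.
Proof. by apply/matrixP => i j; rewrite !mxE /horner_eval hornerC. Qed.

(** On the family [T], the trace of the word is the Laurent polynomial p / t^N.
    The bound on the size says that p has degree greater than N: there is a
    term of positive degree. *)
Definition grows k (G : 'I_k -> 'M[F]_2) (m : 'I_k -> int)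
    (D : pred F) (T : F -> 'M[F]_2) : Prop :=
  exists N (p : {poly F}), (N.+1 < size p)%N /\
    forall t, D t -> t ^+ N * \tr (word G m (T t)) = p.[t].

(** This is ['X^|m|] times diag('X^m, 'X^-m): the power of the generic element of
    the torus, cleared of its denominator. *)
Definition torusX (m : int) : 'M[{poly F}]_2 :=
  diag_mx (\row_j if (j == 0) == (0 <= m) then 'X^((absz m).*2) else 1).

Lemma eval_torusX t m : t != 0 -> eval_mx t (torusX m) = t ^+ absz m *: torus (t ^ m).
Proof.
move=> t0; rewrite /eval_mx map_diag_mx -linearZ; congr diag_mx.
apply/rowP => j; rewrite !mxE; have u0 := expf_neq0 (absz m) t0.
case: (lerP 0 m) => hm.
  rewrite -[in t ^ m](gez0_abs hm) -exprnP eqb_id.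
  by case: ifP => _; rewrite /= /horner_eval !hornerE -?addnn ?exprD ?divff.
rewrite -[in t ^ m](opprK m) -[in t ^ _](ltz0_abs hm) -invr_expz -exprnP eqbF_neg.
by case: (j == 0); rewrite /= /horner_eval !hornerE -?addnn ?exprD ?invrK ?divff.
Qed.

Lemma torus_grows k (G : 'I_k -> 'M[F]_2) (m : 'I_k -> int) :
  (0 < k)%N -> (forall i, m i != 0) -> (forall i r c, G i r c != 0) ->
  grows G m (fun t => t != 0) (@torus F).
Proof.
move=> k0 m0 G0; pose M i := map_mx polyC (G i) * torusX (m i).
have dM i : dominant predT (absz (m i)).*2 (M i).
  have E r c : M i r c = if (c == 0) == (0 <= m i)
                         then G i r c *: 'X^((absz (m i)).*2) else (G i r c)%:P.
    rewrite !mxE (bigD1 c) //= big1 ?addr0 => [|j jc].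
      rewrite !mxE eqxx mulr1n; case: ifP => _; last by rewrite mulr1.
      by rewrite mul_polyC.
    by rewrite !mxE (negPf jc) mulr0n mulr0.
  split=> [r c|].
    rewrite E; case: ifP => _; first by rewrite size_scale ?G0 // size_polyXn.
    by rewrite size_polyC G0.
  (* t^m dominates for m > 0, and t^-m, in the second column, for m < 0. *)
  exists (if 0 <= m i then 0 else 1) => // r c; rewrite !E; split.
    have hb b : c != (if b then 0 else 1) -> ((c == 0) == b) = false.
      by case: b; case: c => -[|[]].
    by move=> /hb ->; rewrite coefC double_eq0 absz_eq0 (negPf (m0 i)).
  by case: (0 <= m i) => /= _; rewrite coefZ coefXn eqxx mulr1.
(* The degree of the cleared trace is 2 N, and N > 0 because k > 0. *)
exists (\sum_i absz (m i))%N, (\tr (\prod_i M i)); split.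
  rewrite (dominant_tr (dominant_prod k0 dM)) ltnS.
  rewrite -(eq_bigr _ (fun i _ => muln2 _)) -big_distrl /= muln2 -addnn.
  rewrite -[ltnLHS]add0n ltn_add2r lt0n sum_nat_eq0.
  by apply/forallPn; exists (Ordinal k0); rewrite /= absz_eq0.
move=> t t0; rewrite /word; apply: horner_tr_prod => i.
rewrite /eval_mx rmorphM /= -!/(eval_mx t _) eval_mxC eval_torusX // torusXz //.
by rewrite scalerAr.
Qed.

Definition unipX (m : int) : 'M[{poly F}]_2 :=
  1 + (m%:~R *: 'X) *: delta_mx 0 1.

Lemma unip_grows k (G : 'I_k -> 'M[F]_2) (m : 'I_k -> int) :
  (0 < k)%N -> (forall i, (m i)%:~R != 0 :> F) -> (forall i, G i 1 0 != 0) ->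
  grows G m predT (@unip F).
Proof.
move=> k0 m0 G0; pose M i := map_mx polyC (G i) * unipX (m i).
have E i r c : M i r c = if c == 1 then (G i r 1)%:P + ((m i)%:~R * G i r 0) *: 'X
                         else (G i r 0)%:P.
  rewrite !mxE sum_ord2 !mxE /=.
  case: (ord2P c); rewrite /= !(mulr0, mulr1, add0r, addr0) //.
  by rewrite addrC -!mul_polyC polyCM; ring.
(* The leading coefficient is m_i times the first column of G_i, sitting in the
   second column; only its lower entry meets the second column of the factor
   on the left. *)
have dM i : dominant (fun r => r == 1) 1 (M i).
  split=> [r c|].
    rewrite E; case: ifP => _; last by rewrite (leq_trans (size_polyC_leq1 _)).
    rewrite (leq_trans (size_polyD _ _)) // geq_max (leq_trans (size_polyC_leq1 _)) //=.
    by rewrite (leq_trans (size_scale_leq _ _)) ?size_polyX.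
  exists 1 => // r c; rewrite !E; split=> [/negPf ->|/eqP ->]; first by rewrite coefC.
  by rewrite eqxx coefD coefC coefZ coefX mulr1 add0r mulf_neq0.
exists 0%N, (\tr (\prod_i M i)); split.
  by rewrite (dominant_tr (dominant_prod k0 dM)) sum_nat_const muln1 card_ord.
move=> t _; rewrite /word.
have -> : t ^+ 0 = t ^+ (\sum_(i < k) 0) by rewrite big1.
apply: horner_tr_prod => i; rewrite expr0 scale1r.
rewrite /eval_mx rmorphM /= -!/(eval_mx t _) eval_mxC unipXz; congr (_ * _).
apply/matrixP => a b; rewrite !mxE /horner_eval !hornerE.
by case: (a == b); case: (_ && _); rewrite !hornerE.
Qed.

End TracePolynomial.

(** * Conjugation and lifting to SL_2 *)

Section Conj.
Variable F : fieldType.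

Lemma word_map (K : fieldType) (iota : {rmorphism K -> F}) k
    (G : 'I_k -> 'M[K]_2) m (X : 'M[K]_2) : X \is a GRing.unit ->
  map_mx iota (word G m X) = word (fun i => map_mx iota (G i)) m (map_mx iota X).
Proof.
move=> uX; rewrite [LHS](rmorph_prod (map_mx iota)); apply: eq_bigr => i _.
by rewrite rmorphM /= (rmorphXz (map_mx iota)).
Qed.

Lemma word_conj (P : 'M[F]_2) k (G : 'I_k -> 'M[F]_2) m (X : 'M[F]_2) :
  P \is a GRing.unit -> X \is a GRing.unit ->
  \tr (word G m (P * X * P^-1)) = \tr (word (fun i => P^-1 * G i * P) m X).
Proof.
move=> uP uX; pose f (Y : 'M[F]_2) := P * Y * P^-1.
have f1 : f 1 = 1 by rewrite /f mulr1 mulrV.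
have fM : {morph f : Y Z / Y * Z} by move=> Y Z; rewrite /f !mulrA mulrVK.
have fX n Y : f (Y ^+ n) = f Y ^+ n.
  by elim: n => [|n IH]; rewrite ?expr0 // !exprS fM IH.
have fXz j Y : Y \is a GRing.unit -> f (Y ^ j) = f Y ^ j.
  case: j => n uY; first exact: fX.
  rewrite /exprz -fX.
  by rewrite /f invrM ?unitrV ?unitrMl ?unitrX // invrM ?unitrX // invrK mulrA.
have E : word G m (f X) = f (word (fun i => P^-1 * G i * P) m X).
  rewrite /word (big_morph f fM f1); apply: eq_bigr => i _.
  by rewrite fM fXz // /f !mulrA mulrK // mulrV // mul1r.
by rewrite [word _ _ _]E /f -mulrA -mulmxE mxtrace_mulC mulmxE mulrVK.
Qed.

End Conj.

Section SL2Word.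
Variables (K : fieldType).

Lemma val_SL2_zexpg (A : SL2 K) j : val (zexpg A j) = val A ^ j.
Proof.
have E n : val (A ^+ n)%g = val A ^+ n.
  elim: n => [|n IH]; first by rewrite expg0 expr0.
  by rewrite expgS exprS -IH.
case: j => n; first exact: E.
by rewrite -[LHS]/(invmx (val (A ^+ n.+1)%g)) E.
Qed.

Lemma pi_zexpg (A : SL2 K) j : \pi_(PSL2 K) (zexpg A j) = zexpg (\pi_(PSL2 K) A) j.
Proof.
have E n : \pi_(PSL2 K) (A ^+ n)%g = (\pi_(PSL2 K) A ^+ n)%g.
  elim: n => [|n IH]; first by rewrite !expg0.
  by rewrite !expgS PSL2_piM IH.
case: j => n; first exact: E.
by rewrite /zexpg PSL2_piV E.
Qed.

Definition lift_word k (g : 'I_k -> PSL2 K) (m : 'I_k -> int) (A : SL2 K) : SL2 K :=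
  (\prod_(i < k) (repr (g i) * zexpg A (m i)))%g.

Lemma val_lift_word k (g : 'I_k -> PSL2 K) m A :
  val (lift_word g m A) = word (fun i => val (repr (g i))) m (val A).
Proof.
rewrite /lift_word /word.
rewrite (@big_morph _ _ (fun B : SL2 K => val B : 'M[K]_2) 1 *%R) //.
by apply: eq_bigr => i _; rewrite -val_SL2_zexpg.
Qed.

End SL2Word.

Lemma phi_pi (R : realType) (K : scalars R) k (g : 'I_k -> PSL2 K) m (A : SL2 K) :
  phi g m (\pi A) = \pi_(PSL2 K) (lift_word g m A).
Proof.
rewrite /lift_word (big_morph _ (@PSL2_piM K) erefl).
by apply: eq_bigr => i _; rewrite PSL2_piM reprK pi_zexpg.
Qed.

(** * Polynomials at infinity *)

Record absolute_value (R : realFieldType) (F : fieldType) (v : F -> R) : Prop :=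
  AbsoluteValue {
    absv_gt0 : forall x, x != 0 -> 0 < v x;
    absv0 : v 0 = 0;
    absvM : {morph v : x y / x * y};
    absv_le : forall x y, v (x + y) <= v x + v y;
    absvN : forall x, v (- x) = v x }.

Section Growth.
Variables (R : realFieldType) (F : fieldType) (v : F -> R).
Hypothesis vP : absolute_value v.

Lemma absv_ge0 x : 0 <= v x.
Proof. by have [->|/(absv_gt0 vP)/ltW//] := eqVneq x 0; rewrite absv0. Qed.

Lemma absvX x n : v (x ^+ n) = v x ^+ n.
Proof.
have v1 : v 1 = 1.
  have v1 := absv_gt0 vP (oner_neq0 F).
  by apply: (mulfI (lt0r_neq0 v1)); rewrite -absvM // !mulr1.
by elim: n => [|n IH]; rewrite ?expr0 // !exprS absvM // IH.
Qed.

(** Induction along the Horner scheme p = q 'X + c: one factor t is gained at each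
    step, and for v t >= 1 the constant c is absorbed in v c * v t ^+ N. *)
Lemma poly_growth (p : {poly F}) N (M : R) : (N.+1 < size p)%N ->
  exists B, forall t, B < v t -> M * v t ^+ N < v p.[t].
Proof.
elim/poly_ind: p N M => [|q c IH] N M; first by rewrite size_poly0.
have [->|q0] := eqVneq q 0.
  by rewrite mul0r add0r ltnNge (leq_trans (size_polyC_leq1 _)).
rewrite size_MXaddC (negPf q0) /= ltnS => sq.
have low t : v q.[t] * v t - v c <= v (q * 'X + c%:P).[t].
  rewrite !hornerE lerBlDr -absvM //.
  rewrite -[X in v X <= _](addrK c) -(absvN vP c).
  exact: absv_le.
have c0 := absv_ge0 c.
case: N sq => [|N] sq.
  have [q1|q1] := ltnP 1 (size q).
    have [B hB] := IH 0%N 1 q1; exists (Num.max B (`|M| + v c)) => t.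
    rewrite gt_max => /andP[/hB + Mt]; rewrite !expr0 !mulr1 => q_gt.
    apply: lt_le_trans (low t); have := ler_norm M; have := absv_ge0 t; nra.
  have [a a0 E] : exists2 a, a != 0 & q = a%:P.
    exists q`_0; last exact: size1_polyC.
    by rewrite -lead_coef_eq0 lead_coefE (eqP (_ : size q == 1)%N) ?eqn_leq ?q1 in q0.
  have va := absv_gt0 vP a0.
  exists ((M + v c) / v a) => t; rewrite ltr_pdivrMr // => Bt.
  by rewrite expr0 mulr1; apply: lt_le_trans (low t); rewrite E hornerC; nra.
have [B hB] := IH N (M + v c) sq; exists (Num.max B 1) => t.
rewrite gt_max => /andP[/hB q_gt t1]; apply: lt_le_trans (low t).
have tN : 1 <= v t ^+ N.+1 by rewrite exprn_ege1 // ltW.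
have : (M + v c) * v t ^+ N * v t < v q.[t] * v t by rewrite ltr_pM2r //; lra.
rewrite -mulrA -exprSr; nra.
Qed.

End Growth.

(** * Finiteness and divergence along a conjugated family *)

Lemma finite_roots (F : fieldType) (p : {poly F}) :
  p != 0 -> finite_set [set t | root p t].
Proof.
move=> p0; apply: contrapT => /(infinite_set_fset (size p))[B Bp].
apply/negP; rewrite -ltnNge; apply: max_poly_roots (finmap.fset_uniq _) => //.
by apply/allP => t tB; apply: Bp.
Qed.

Lemma finite_set_choose (T : Type) (U : choiceType) (S : set U) (A : set T)
    (rel : U -> T -> Prop) :
  finite_set A -> (forall x, S x -> exists2 t, A t & rel x t) ->
  (forall x y t, rel x t -> rel y t -> x = y) -> finite_set S.
Proof.
move=> finA hS rel_inj.
have [x0|/forallNP S0] := pselect (exists x, S x); last first.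
  by rewrite (_ : S = set0) // -subset0 => x /S0.
pose e t := xget (projT1 (cid x0)) [set x | rel x t].
apply: sub_finite_set (finite_image e finA) => x /hS[t At xt].
exists t => //; apply: rel_inj (xt).
by apply: (@xgetPex _ _ [set x | rel x t]); exists x.
Qed.

Section Families.
Variables (R : realType) (K : scalars R).

(** The field extension [iota] is there for the rotations of the real hyperbolic
    plane, which are diagonalizable over C only. *)
Definition conj_family (F : fieldType) (iota : {rmorphism K -> F})
    (P : 'M[F]_2) (D : pred F) (T : F -> 'M[F]_2) (mu : set (PSL2 K)) : Prop :=
  forall nu, mu nu -> exists (A : SL2 K) t,
    [/\ nu = \pi A, D t & map_mx iota (val A) = P * T t * P^-1].

Variables (k : nat) (g : 'I_k -> PSL2 K) (m : 'I_k -> int) (mu : set (PSL2 K)).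

Definition conj_coefs (F : fieldType) (iota : {rmorphism K -> F})
    (P : 'M[F]_2) (i : 'I_k) : 'M[F]_2 :=
  P^-1 * map_mx iota (val (repr (g i))) * P.

Lemma SL2_unitr (A : SL2 K) : (val A : 'M[K]_2) \is a GRing.unit.
Proof. exact: SL2_unit. Qed.

Lemma tr_lift_word (F : fieldType) (iota : {rmorphism K -> F}) (P : 'M[F]_2)
    (A : SL2 K) (X : 'M[F]_2) :
  P \is a GRing.unit -> X \is a GRing.unit ->
  map_mx iota (val A) = P * X * P^-1 ->
  iota (\tr (val (lift_word g m A))) = \tr (word (conj_coefs iota P) m X).
Proof.
move=> uP uX AX.
by rewrite val_lift_word -trace_map_mx word_map ?SL2_unitr // AX word_conj.
Qed.

(** If tr^2 = x at parameter t, then t is a root of p^2 - x 'X^(2N), which is not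
    the zero polynomial since p^2 has degree greater than 2N; and t determines
    nu. *)
Lemma finite_fibre (F : fieldType) (iota : {rmorphism K -> F}) (P : 'M[F]_2)
    (D : pred F) (T : F -> 'M[F]_2) :
  P \is a GRing.unit -> (forall t, D t -> T t \is a GRing.unit) ->
  grows (conj_coefs iota P) m D T -> conj_family iota P D T mu ->
  forall x : K, finite_set [set nu | mu nu /\ PSL2_tr2 (phi g m nu) = x].
Proof.
move=> uP uT [N [p [sp pE]]] muT x.
have : finite_set [set t | root (p ^+ 2 - iota x *: 'X^(N.*2)) t].
  apply: finite_roots; rewrite subr_eq0; apply: contraTneq sp => pq.
  rewrite -leqNgt; have := size_scale_leq (iota x) 'X^(N.*2).
  rewrite -pq size_polyXn; have [->|p0] := eqVneq p 0; first by rewrite size_poly0.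
  by rewrite expr2 size_mul //; move: (size p) => s; lia.
pose rel (nu : PSL2 K) t := exists A : SL2 K,
  nu = \pi A /\ map_mx iota (val A) = P * T t * P^-1.
move=> /(@finite_set_choose _ _ _ _ rel); apply=> [nu|nu nu' t].
- move=> [/muT[A [t [-> Dt AT]]] xE]; exists t; last by exists A.
  rewrite /= rootE !hornerE -pE // -xE phi_pi PSL2_tr2_pi.
  rewrite rmorphXn /= (tr_lift_word uP (uT _ Dt) AT) exprMn -exprM muln2.
  by rewrite subr_eq0 mulrC.
- move=> [A [-> EA]] [B [-> EB]]; congr (\pi _); apply: val_inj.
  by apply: (map_mx_inj (f := iota)); rewrite EA EB.
Qed.

Lemma cvg_norm_to_oo (f : PSL2 K -> R) :
  (forall M, exists B, forall nu, mu nu -> B < PSL2_norm nu -> M < f nu) ->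
  f nu @[nu --> norm_to_oo mu] --> +oo.
Proof.
move=> fB A [M [_ MA]]; have [B hB] := fB M.
by exists B => nu mnu Bnu; apply/MA/hB.
Qed.

Hypothesis hK : K = real_scalars R \/ K = complex_scalars R.

Lemma absK_absolute_value : absolute_value (@absK R K).
Proof.
case: hK => ->.
  split=> //=; [by move=> x; rewrite normr_gt0|exact: normr0|exact: normrM|
    exact: ler_normD|exact: normrN].
split=> /=; [|exact: Normc.normc0|exact: Normc.normcM|exact: le_normcD|exact: normcN].
move=> x x0; rewrite lt_neqAle; apply/andP; split.
  by rewrite eq_sym; apply: contra_neq x0; exact: Normc.eq0_normc.
by case: x {x0} => a b; exact: sqrtr_ge0.
Qed.
Let absP := absK_absolute_value.

Lemma tr_growth (G : 'I_k -> 'M[K]_2) (D : pred K) T : grows G m D T ->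
  forall M, exists B, forall t, D t -> B < absK t ->
    M < absK (\tr (word G m (T t))).
Proof.
move=> [N [p [sp pE]]] M; have [B hB] := poly_growth absP M sp.
exists (Num.max B 0) => t Dt; rewrite gt_max => /andP[/hB + t0].
rewrite -pE // (absvM absP) (absvX absP) mulrC ltr_pM2l //.
exact: exprn_gt0.
Qed.

Definition bounded_mx (C : R) (A : 'M[K]_2) := forall i j, absK (A i j) <= C.

Lemma bounded_mx_ex (A : 'M[K]_2) : exists C, bounded_mx C A.
Proof.
exists (\sum_i \sum_j absK (A i j)) => i j.
rewrite !sum_ord2; have a := absv_ge0 absP.
have := a (A 0 0); have := a (A 0 1); have := a (A 1 0); have := a (A 1 1).
by case: (ord2P i); case: (ord2P j); lra.
Qed.

Lemma bounded_mxM C C' A A' :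
  bounded_mx C A -> bounded_mx C' A' -> bounded_mx (2 * (C * C')) (A * A').
Proof.
move=> hA hA' i j; rewrite !mxE sum_ord2; have a := absv_ge0 absP.
apply: le_trans (absv_le absP _ _) _; rewrite !(absvM absP).
have := ler_pM (a _) (a _) (hA i 0) (hA' 0 j).
have := ler_pM (a _) (a _) (hA i 1) (hA' 1 j); lra.
Qed.

Lemma PSL2_norm_bounded C (A : SL2 K) :
  bounded_mx C (val A) -> PSL2_norm (\pi_(PSL2 K) A) <= 2 * C.
Proof.
move=> hA; rewrite PSL2_norm_pi //.
have C0 : 0 <= C := le_trans (absv_ge0 absP _) (hA 0 0).
have -> : 2 * C = Num.sqrt ((2 * C) ^+ 2) by rewrite sqrtr_sqr ger0_norm; lra.
rewrite ler_wsqrtr // !sum_ord2.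
have h i j : absK (val A i j) ^+ 2 <= C ^+ 2.
  by rewrite ler_pXn2r ?nnegrE // absv_ge0.
have := h 0 0; have := h 0 1; have := h 1 0; have := h 1 1; rewrite exprMn; lra.
Qed.

Lemma conj_bounded (P : 'M[K]_2) C : exists C', forall (A : SL2 K) X,
  map_mx idfun (val A) = P * X * P^-1 -> bounded_mx C X ->
  PSL2_norm (\pi_(PSL2 K) A) <= C'.
Proof.
have [p hp] := bounded_mx_ex P; have [q hq] := bounded_mx_ex P^-1.
exists (2 * (2 * (2 * (p * C) * q))) => A X; rewrite map_mx_id // => AX hX.
by apply: PSL2_norm_bounded; rewrite AX; apply/bounded_mxM/hq/bounded_mxM.
Qed.

(** Bounded parameters give bounded matrices, so a large norm forces a large
    parameter. *)
Lemma unip_diverges (P : 'M[K]_2) : P \is a GRing.unit ->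
  grows (conj_coefs idfun P) m predT (@unip K) ->
  conj_family idfun P predT (@unip K) mu ->
  PSL2_abs_tr (phi g m nu) @[nu --> norm_to_oo mu] --> +oo.
Proof.
move=> uP /tr_growth tG muT; apply: cvg_norm_to_oo => M.
have [B hB] := tG M; have [C hC] := conj_bounded P (B + absK (1 : K)).
exists C => _ /muT[A [s [-> Ds As]]] CA.
rewrite phi_pi PSL2_abs_tr_pi //.
rewrite -[\tr _]/(idfun _) (tr_lift_word uP (unip_unit s) As).
apply: hB => //; rewrite ltNge; apply: contraL CA => sB; rewrite -leNgt.
have s0 := absv_ge0 absP s; have l0 := absv_ge0 absP 1.
apply: hC As _ => i j; rewrite !mxE.
case: (ord2P i); case: (ord2P j);
  rewrite /= ?(mulr0, mulr1, addr0, add0r) ?(absv0 absP); lra.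
Qed.

(** A large norm forces t or 1/t to be large. Conjugation by the exchange [J] of
    the two axes inverts t and permutes the entries of the g_i, so the growth at
    infinity also yields the growth at t = 0. *)
Lemma torus_diverges (P : 'M[K]_2) : P \is a GRing.unit ->
  (0 < k)%N -> (forall i, m i != 0) ->
  (forall i r c, conj_coefs idfun P i r c != 0) ->
  conj_family idfun P (fun t => t != 0) (@torus K) mu ->
  PSL2_abs_tr (phi g m nu) @[nu --> norm_to_oo mu] --> +oo.
Proof.
move=> uP k0 m0 G0 muT; apply: cvg_norm_to_oo => M.
have [B hB] := tr_growth (torus_grows k0 m0 G0) M.
pose J : 'M[K]_2 := \matrix_(i, j) (i != j)%:R.
have JJ : J * J = 1.
  by apply/matrixP => i j; rewrite !mxE sum_ord2 !mxE;
    case: (ord2P i); case: (ord2P j); rewrite /= ?(mulr0, mulr1, addr0, add0r).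
have uJ : J \is a GRing.unit by apply/unitrP; exists J.
have JV : J^-1 = J by apply: (mulrI uJ); rewrite mulrV.
have JT t : J * torus t * J = torus t^-1.
  apply/matrixP => i j; rewrite !mxE !sum_ord2 !mxE !sum_ord2 !mxE.
  by case: (ord2P i); case: (ord2P j);
    rewrite /= ?(mulr0, mul0r, mulr1, mul1r, addr0, add0r, mulr0n, mulr1n, invrK).
have uPJ : P * J \is a GRing.unit by rewrite unitrMl.
have G0' i r c : conj_coefs idfun (P * J) i r c != 0.
  have -> : conj_coefs idfun (P * J) i = J * conj_coefs idfun P i * J.
    by rewrite /conj_coefs invrM // JV !mulrA.
  move: (conj_coefs idfun P i) (G0 i) => H H0.
  rewrite !mxE !sum_ord2 !mxE !sum_ord2 !mxE.
  by case: (ord2P r); case: (ord2P c);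
    rewrite /= ?(mulr0, mul0r, mulr1, mul1r, addr0, add0r) H0.
have [B' hB'] := tr_growth (torus_grows k0 m0 G0') M.
have [C hC] := conj_bounded P (Num.max B B').
exists C => _ /muT[A [t [-> Dt At]]] CA.
have At' : map_mx idfun (val A) = (P * J) * torus t^-1 * (P * J)^-1.
  have JK (X : 'M[K]_2) : X * J * J = X by rewrite -mulrA JJ mulr1.
  by rewrite At invrM // JV -JT !mulrA !JK.
rewrite phi_pi PSL2_abs_tr_pi //.
have [tB|/(hB t Dt)] := leP (absK t) B; last first.
  by move=> hM; rewrite -[\tr _]/(idfun _) (tr_lift_word uP (torus_unit Dt) At).
rewrite -[\tr _]/(idfun _) (tr_lift_word uPJ _ At') ?torus_unit ?invr_eq0 //.
apply: hB'; rewrite ?invr_eq0 //.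
rewrite ltNge; apply: contraL CA => tB'; rewrite -leNgt.
have C0 : 0 <= Num.max B B' by rewrite le_max (le_trans (absv_ge0 absP _) tB).
apply: hC At _ => i j; rewrite !mxE.
case: (ord2P i); case: (ord2P j);
  by rewrite /= ?(mulr0n, mulr1n) ?(absv0 absP) // le_max ?tB ?tB' ?orbT.
Qed.

End Families.

(** * Normal forms and their centralizers *)

Section Mx2.
Variable F : fieldType.
Implicit Types A B P N : 'M[F]_2.

Lemma det2 A : \det A = A 0 0 * A 1 1 - A 0 1 * A 1 0.
Proof.
rewrite (expand_det_row _ 0) sum_ord2 /cofactor !det_mx11 !mxE /=.
rewrite !expr0 expr1 mul1r mulN1r mulrN; congr (_ * A _ _ - _ * A _ _); exact: val_inj.
Qed.

Lemma tr2 A : \tr A = A 0 0 + A 1 1.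
Proof. exact: sum_ord2. Qed.

Lemma Cayley_Hamilton2 A : A * A = \tr A *: A - (\det A)%:M.
Proof.
apply/matrixP => i j; rewrite !mxE sum_ord2 tr2 det2.
by case: (ord2P i); case: (ord2P j); rewrite /= ?mulr1n ?mulr0n; ring.
Qed.

Lemma eigenvector_ex A (l : F) : \det (A - l%:M) = 0 ->
  exists2 u : 'cV[F]_2, u != 0 & A *m u = l *: u.
Proof.
rewrite -det_tr => /eqP/det0P[v v0 vA]; exists v^T; first by rewrite trmx_eq0.
apply/eqP; rewrite -mul_scalar_mx -subr_eq0 -mulmxBl -trmx_eq0.
by rewrite trmx_mul trmxK vA.
Qed.

Definition cols (u w : 'cV[F]_2) : 'M[F]_2 :=
  \matrix_(i, j) if j == 0 then u i 0 else w i 0.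

Lemma cols_unit u w :
  (forall a b, a *: u + b *: w = 0 -> a = 0 /\ b = 0) ->
  cols u w \is a GRing.unit.
Proof.
move=> uw; rewrite -[_ \is a _]unitmx_tr unitmxE unitfE.
apply/det0P => -[v v0 vP]; case/eqP: v0.
have [|v0 v1] := uw (v 0 0) (v 0 1).
  apply/matrixP => i j; have /matrixP/(_ 0 i) := vP.
  by rewrite !mxE sum_ord2 !mxE /= (ord1 j).
by apply/rowP => i; rewrite !mxE; case: (ord2P i).
Qed.

Lemma mul_col A P c : A *m col c P = col c (A * P).
Proof. by apply/matrixP => i j; rewrite !mxE; apply: eq_bigr => k _; rewrite !mxE. Qed.

(** The columns of P span the coordinate axes: a zero entry in row r and
    column c of P^-1 A P says that A carries the c-th axis to the r'-th one. *)
Lemma conj_entry0 P A r r' c : P \is a GRing.unit -> r != r' ->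
  (P^-1 * A * P) r c = 0 ->
  A *m col c P = (P^-1 * A * P) r' c *: col r' P.
Proof.
move=> uP rr'.
have -> : A *m col c P = col c (P * (P^-1 * A * P)).
  by rewrite mul_col !mulrA mulrV // mul1r.
move: (P^-1 * A * P) => N; move: rr'.
case: (ord2P r); case: (ord2P r') => // _ N0; apply/matrixP => i j;
  by rewrite !mxE sum_ord2 N0; ring.
Qed.

Lemma unit_col_neq0 P c : P \is a GRing.unit -> col c P != 0.
Proof.
move=> uP; apply/eqP; rewrite colE => /(congr1 (mulmx (invmx P))).
rewrite mulmxA mulVmx // mul1mx mulmx0 => /matrixP/(_ c 0)/eqP.
by rewrite !mxE !eqxx oner_eq0.
Qed.

Lemma commute_torus N (l : F) : l != 0 -> l != l^-1 -> \det N = 1 ->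
  N * torus l = torus l * N -> exists2 t, t != 0 & N = torus t.
Proof.
move=> l0 ll' dN /matrixP NT.
have N01 : N 0 1 = 0.
  have := NT 0 1; rewrite !mxE !sum_ord2 !mxE /= !mulr0n !mulr1n.
  rewrite mulr0 mul0r addr0 add0r => /eqP; rewrite mulrC -subr_eq0 -mulrBl mulf_eq0.
  by rewrite subr_eq0 eq_sym (negPf ll') => /eqP.
have N10 : N 1 0 = 0.
  have := NT 1 0; rewrite !mxE !sum_ord2 !mxE /= !mulr0n !mulr1n.
  rewrite mulr0 mul0r addr0 add0r => /eqP; rewrite mulrC -subr_eq0 -mulrBl mulf_eq0.
  by rewrite subr_eq0 (negPf ll') => /eqP.
move: dN; rewrite det2 N01 mul0r subr0 => dN.
have N00 : N 0 0 != 0 by apply: contra_eqN dN => /eqP ->; rewrite mul0r eq_sym oner_eq0.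
exists (N 0 0) => //; apply/matrixP => i j; rewrite !mxE.
case: (ord2P i); case: (ord2P j); rewrite /= ?mulr1n ?mulr0n //.
by apply: (mulfI N00); rewrite dN mulfV.
Qed.

Lemma commute_unip N : \det N = 1 ->
  N * delta_mx 0 1 = delta_mx 0 1 * N :> 'M[F]_2 ->
  exists s, N = unip s \/ N = - unip s.
Proof.
move=> dN /matrixP NT.
have N10 : N 1 0 = 0.
  have := NT 1 1; rewrite !mxE !sum_ord2 !mxE /=.
  by rewrite !(mulr0, mul0r, mulr1, mul1r, addr0, add0r).
have N00 : N 0 0 = N 1 1.
  have := NT 0 1; rewrite !mxE !sum_ord2 !mxE /=.
  by rewrite !(mulr0, mul0r, mulr1, mul1r, addr0, add0r).
move: dN; rewrite det2 N10 mulr0 subr0 N00 -expr2 => /eqP.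
rewrite sqrf_eq1 => /orP[] /eqP N11.
  exists (N 0 1); left; apply/matrixP => i j; rewrite !mxE.
  by case: (ord2P i); case: (ord2P j); rewrite /= ?N00 ?N11 ?N10; ring.
exists (- N 0 1); right; apply/matrixP => i j; rewrite !mxE.
by case: (ord2P i); case: (ord2P j); rewrite /= ?N00 ?N11 ?N10; ring.
Qed.

End Mx2.

Section Reduction.
Variable F : numFieldType.
Implicit Types A P : 'M[F]_2.

(** The eigenvalues are (tr A + d) / 2 and (tr A - d) / 2, of product
    det A = 1. *)
Lemma torus_reduction A (d : F) : \det A = 1 -> d != 0 -> d ^+ 2 = \tr A ^+ 2 - 4 ->
  exists P l, [/\ P \is a GRing.unit, l != 0, l != l^-1 & A * P = P * torus l].
Proof.
move=> dA d0 dE; pose l := (\tr A + d) / 2; pose l' := (\tr A - d) / 2.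
have ll' : l * l' = 1.
  by rewrite /l /l' (_ : _ * _ = (\tr A ^+ 2 - d ^+ 2) / 4); [rewrite dE; field|field].
have l0 : l != 0 by apply: contra_eqN ll' => /eqP ->; rewrite mul0r eq_sym oner_eq0.
have lV : l^-1 = l' by apply: (mulfI l0); rewrite mulfV.
have l_l' : l - l' != 0 by rewrite (_ : l - l' = d) // /l /l'; field.
have sum : l + l' = \tr A by rewrite /l /l'; field.
have det_sub x : \det (A - x%:M) = x ^+ 2 - \tr A * x + 1.
  by rewrite -dA !det2 !mxE /= tr2; ring.
have [|u u0 Au] := @eigenvector_ex F A l.
  by rewrite det_sub -sum -ll'; ring.
have [|w w0 Aw] := @eigenvector_ex F A l'.
  by rewrite det_sub -sum -ll'; ring.
exists (cols u w), l; rewrite l0 lV -subr_eq0 l_l'; split=> //; last first.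
  apply/matrixP => i j; have /matrixP/(_ i 0) := Au; have /matrixP/(_ i 0) := Aw.
  rewrite !mxE !sum_ord2 !mxE lV /=.
  by case: (ord2P j); rewrite /= => hw hu; [rewrite hu | rewrite hw]; ring.
apply: cols_unit => a b ab.
have : A *m (a *: u + b *: w) = 0 by rewrite ab mulmx0.
rewrite mulmxDr -!scalemxAr Au Aw => ab'.
have : b *: ((l - l') *: w) = 0.
  rewrite -[RHS](subr0 0) -[X in _ = X - _](scaler0 _ l) -{1}ab -ab' scalerDr.
  by apply/matrixP => i j; rewrite !mxE; ring.
move/eqP; rewrite !scaler_eq0 (negPf l_l') (negPf w0) !orbF => /eqP b0.
move: ab; rewrite b0 scale0r addr0 => /eqP.
by rewrite scaler_eq0 (negPf u0) orbF => /eqP.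
Qed.

(** With the double eigenvalue l = tr A / 2, Cayley-Hamilton makes u = (A - l) w
    an eigenvector for every w; a basis vector w with u <> 0 exists since A is
    not scalar. *)
Lemma unip_reduction A : \det A = 1 -> \tr A ^+ 2 = 4 -> A != 1 -> A != - 1 ->
  exists P l, P \is a GRing.unit /\ A * P = P * (l%:M + delta_mx 0 1).
Proof.
move=> dA tA A1 AN1; pose l := \tr A / 2.
have l2 : l ^+ 2 = 1 by rewrite /l expr_div_n tA; field.
have tl : \tr A = 2 * l by rewrite /l; field.
have Al : A - l%:M != 0.
  rewrite subr_eq0; move/eqP: l2; rewrite sqrf_eq1 => /orP[] /eqP -> //.
  by rewrite raddfN.
have dAl : \det A = l ^+ 2 by rewrite dA l2.
have CH : (A - l%:M) * (A - l%:M) = 0.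
  rewrite mulrBl !mulrBr Cayley_Hamilton2 dAl tl.
  apply/matrixP => i j; rewrite !mxE !sum_ord2 !mxE.
  by case: (ord2P i); case: (ord2P j); rewrite /= ?mulr1n ?mulr0n; ring.
have [c Ac] : exists c, col c (A - l%:M) != 0.
  apply/existsP; apply: contraNT Al => /existsPn Al; apply/eqP/matrixP => i j.
  have /eqP/matrixP/(_ i 0) := negbNE (Al j); by rewrite !mxE.
pose u := col c (A - l%:M); pose w : 'cV[F]_2 := delta_mx c 0.
have uE : u = (A - l%:M) *m w.
  by rewrite /u /w colE.
have Au : A *m u = l *: u.
  apply/eqP; rewrite -mul_scalar_mx -subr_eq0 -mulmxBl uE mulmxA mulmxE CH mul0mx //.
have Aw : A *m w = l *: w + u.
  by rewrite uE mulmxBl mul_scalar_mx addrC subrK.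
exists (cols u w), l; split; last first.
  apply/matrixP => i j; have /matrixP/(_ i 0) := Au; have /matrixP/(_ i 0) := Aw.
  rewrite !mxE !sum_ord2 !mxE /=.
  by case: (ord2P j); rewrite /= => hw hu; [rewrite hu | rewrite hw]; ring.
apply: cols_unit => a b ab.
have : A *m (a *: u + b *: w) = 0 by rewrite ab mulmx0.
rewrite mulmxDr -!scalemxAr Au Aw => ab'.
have : b *: u = 0.
  rewrite -[RHS](subr0 0) -[X in _ = _ - X](scaler0 _ l) -{2}ab -ab' scalerDr.
  by apply/matrixP => i j; rewrite !mxE; ring.
move/eqP; rewrite scaler_eq0 (negPf Ac) orbF => /eqP b0.
move: ab; rewrite b0 scale0r addr0 => /eqP.
by rewrite scaler_eq0 (negPf Ac) orbF => /eqP.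
Qed.

End Reduction.

(** * Points at infinity as lines *)

Section Lines.
Variables (R : realType) (K : scalars R).
Hypothesis hK : K = real_scalars R \/ K = complex_scalars R.

Lemma mul_conjK (x : K) : x * conjK x = ofR K (absK x ^+ 2).
Proof.
case: hK x => -> /= x; first by rewrite -normrX ger0_norm ?sqr_ge0 // expr2.
case: x => a b /=; rewrite sqr_sqrtr ?addr_ge0 ?sqr_ge0 //.
apply/eqP; rewrite eq_complex /=; apply/andP; split; apply/eqP; ring.
Qed.

Lemma conjK_neq0 (x : K) : x != 0 -> conjK x != 0.
Proof. by case: hK x => -> //= x; rewrite conjc_eq0. Qed.

Lemma ofR0 : ofR K 0 = 0.
Proof. by case: hK => ->. Qed.

(** The point of the projective line K + {oo} given by homogeneous coordinates. *)
Definition line_point (u : 'cV[K]_2) : hpoint K :=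
  if u 1 0 == 0 then None else boundary_point (u 0 0 / u 1 0).

Lemma line_pointZ c u : c != 0 -> line_point (c *: u) = line_point u.
Proof.
move=> c0; rewrite /line_point !mxE mulf_eq0 (negPf c0) /=.
by case: eqP => // _; rewrite -mulf_div divff // mul1r.
Qed.

Lemma SL2_act_line (A : SL2 K) u : u != 0 ->
  SL2_act A (line_point u) = line_point (val A *m u).
Proof.
have absP := absK_absolute_value hK.
move=> u0; rewrite {1}/line_point; case: eqP => [u1|/eqP u1].
  have u00 : u 0 0 != 0.
    apply: contra_neq u0 => u00; apply/matrixP => i j; rewrite !mxE (ord1 j).
    by case: (ord2P i).
  rewrite /= /line_point !mxE !sum_ord2 u1 !mulr0 !addr0 mulf_eq0 (negPf u00) orbF.
  by case: eqP => // _; rewrite -mulf_div divff // mulr1.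
set z := u 0 0 / u 1 0; have zu : u 0 0 = z * u 1 0 by rewrite /z divfK.
have -> : line_point (val A *m u) =
    let d := val A 1 0 * z + val A 1 1 in
    if d == 0 then None else boundary_point ((val A 0 0 * z + val A 0 1) / d).
  rewrite /line_point !mxE !sum_ord2 zu !mulrA -!mulrDl mulf_eq0 (negPf u1) orbF.
  by case: eqP => // _; rewrite -mulf_div divff // mulr1.
rewrite /SL2_act /boundary_point /mob_den /= expr0n /= mulr0 addr0 sqrf_eq0.
set d := _ * z + _; have -> : (absK d == 0) = (d == 0).
  have [->|/(absv_gt0 absP)/lt0r_neq0/negPf//] := eqVneq d 0.
  by rewrite (absv0 absP) eqxx.
case: eqP => // /eqP d0; congr (Some (_, _)).
  rewrite ofR0 mulr0 addr0 -mul_conjK -mulf_div divff ?conjK_neq0 // mulr1 //.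
by apply/val_inj => /=; rewrite mul0r.
Qed.

Lemma Fix_line_point (mu : set (PSL2 K)) u : u != 0 ->
  (forall nu, mu nu -> exists (A : SL2 K) c,
     [/\ nu = \pi A, c != 0 & val A *m u = c *: u]) ->
  Fix mu (line_point u).
Proof.
move=> u0 hmu nu /hmu[A [c [-> c0 Au]]].
by rewrite PSL2_act_pi // SL2_act_line // Au line_pointZ.
Qed.

(** The form in which the hypothesis on Fix mu is used: g maps no common
    eigenline of mu to a common eigenline. *)
Lemma Fix_disjoint_lines (mu : set (PSL2 K)) (p : PSL2 K) (u w : 'cV[K]_2) c :
  Fix mu `&` (PSL2_act p @` Fix mu) = set0 ->
  u != 0 -> Fix mu (line_point u) -> Fix mu (line_point w) ->
  val (repr p) *m u <> c *: w.
Proof.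
move=> hp u0 fu fw pu; suff: (Fix mu `&` (PSL2_act p @` Fix mu)) (line_point w).
  by rewrite hp.
split=> //; exists (line_point u) => //.
rewrite /PSL2_act SL2_act_line // pu line_pointZ //.
apply: contra_neq u0 => c0; rewrite -[u]mul1mx -(mulVmx (SL2_unit (repr p))).
by rewrite -mulmxA pu c0 scale0r mulmx0.
Qed.

End Lines.

(** * Groups with an eigenline over K *)

Section Cases.
Variables (R : realType) (K : scalars R).
Hypothesis hK : K = real_scalars R \/ K = complex_scalars R.
Variables (k : nat) (g : 'I_k -> PSL2 K) (m : 'I_k -> int) (mu : set (PSL2 K)).
Hypothesis k0 : (0 < k)%N.
Hypothesis m0 : forall i, m i != 0.
Hypothesis hg : forall i, Fix mu `&` (PSL2_act (g i) @` Fix mu) = set0.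

Definition finite_and_proper :=
  (forall x : K,
     finite_set [set nu | mu nu /\ PSL2_tr2 (phi g m nu) = x]) /\
  (~ purely_elliptic mu ->
     PSL2_abs_tr (phi g m nu) @[nu --> norm_to_oo mu] --> +oo).

Lemma finite_group_case : finite_set mu -> finite_and_proper.
Proof.
move=> fmu; split=> [x|_]; first by apply: sub_finite_set fmu => nu [].
apply: cvg_norm_to_oo => M.
have [B hB] : exists B, forall nu, mu nu -> PSL2_norm nu <= B.
  have /finite_seqP[s ->] := fmu.
  exists (\big[Num.max/0]_(nu <- s) PSL2_norm nu) => nu nus.
  exact: le_bigmax_seq.
by exists B => nu /hB; rewrite leNgt => /negP.
Qed.

Lemma torus_case (P : 'M[K]_2) : P \is a GRing.unit ->
  conj_family idfun P (fun t => t != 0) (@torus K) mu -> finite_and_proper.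
Proof.
move=> uP muT.
have P0 c : col c P != 0 by exact: unit_col_neq0.
have fixP c : Fix mu (line_point (col c P)).
  apply: Fix_line_point => // nu /muT[A [t [-> t0]]]; rewrite map_mx_id // => At.
  exists A, (if c == 0 then t else t^-1); split=> //.
    by case: ifP => _; rewrite ?invr_eq0.
  rewrite mul_col At mulrVK //.
  apply/matrixP => i j; rewrite !mxE sum_ord2 !mxE.
  by case: (ord2P c); rewrite /= ?mulr0n ?mulr1n; ring.
have G0 i r c : conj_coefs g idfun P i r c != 0.
  apply/eqP; rewrite /conj_coefs map_mx_id //.
  have rr' : r != (if r == 0 then 1 else 0) by case: (ord2P r).
  by move=> /(conj_entry0 uP rr'); apply: Fix_disjoint_lines (hg i) _ _ _.
split=> [x|_]; last exact: torus_diverges muT.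
exact: (finite_fibre uP (@torus_unit K) (torus_grows k0 m0 G0) muT).
Qed.

Lemma unip_case (P : 'M[K]_2) : P \is a GRing.unit ->
  conj_family idfun P predT (@unip K) mu -> finite_and_proper.
Proof.
move=> uP muT.
have P0 : col 0 P != 0 by exact: unit_col_neq0.
have fixP : Fix mu (line_point (col 0 P)).
  apply: Fix_line_point => // nu /muT[A [s [-> _]]]; rewrite map_mx_id // => As.
  exists A, 1; split=> //; rewrite ?oner_eq0 //.
  rewrite mul_col As mulrVK //.
  by apply/matrixP => i j; rewrite !mxE sum_ord2 !mxE /=; ring.
have G0 i : conj_coefs g idfun P i 1 0 != 0.
  apply/eqP; rewrite /conj_coefs map_mx_id //.
  move=> /(conj_entry0 uP (isT : (1 : 'I_2) != 0)).
  exact: Fix_disjoint_lines (hg i) _ _ _.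
have mK i : (m i)%:~R != 0 :> K by rewrite intr_eq0.
have gr := unip_grows k0 mK G0.
split=> [x|_]; last exact: unip_diverges muT.
exact: (finite_fibre uP (fun t _ => unip_unit t) gr muT).
Qed.

End Cases.

(** * Rotations of the hyperbolic plane *)

Section Elliptic.
Variable R : realType.
Let K := real_scalars R.
Let iota : {rmorphism K -> R[i]} := real_complex R.
Variables (x t : R) (t0 : 0 < t).

(** Real and imaginary part of a z + b = z (c z + d) for z = x + i t, t <> 0: the
    conditions for z to be fixed, made linear in the matrix. *)
Definition stabilizes (A : 'M[R]_2) : Prop :=
  A 0 0 = 2 * A 1 0 * x + A 1 1 /\ A 0 1 = - A 1 0 * (x ^+ 2 + t ^+ 2).

Lemma stabilizes_act (A : SL2 K) : stabilizes (val A) ->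
  SL2_act A (Some (x, NngNum (ltW t0))) = Some (x, NngNum (ltW t0)).
Proof.
move=> [a b]; have := SL2_det A; rewrite det2 => dA.
have n1 : mob_den (val A 1 0) (val A 1 1) (x : K) t = 1.
  rewrite /mob_den /= !real_normK ?num_real // -[RHS]dA a b; ring.
rewrite /SL2_act /= n1 oner_eq0; congr (Some (_, _)).
  rewrite -[RHS](mulr1 x) -[in RHS]dA a b invr1 mulr1; ring.
by apply/val_inj; rewrite /= n1 divr1.
Qed.

(** Its columns are the eigenvectors (z, 1) and (z^*, 1) of the stabilizer of
    z = x + i t. *)
Definition ellP : 'M[R[i]]_2 :=
  \matrix_(i, j) if i == 0 then (if j == 0 then (x +i* t)%C else (x -i* t)%C) else 1.

Lemma ellP_unit : ellP \is a GRing.unit.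
Proof.
rewrite -[_ \is a _]/(ellP \in unitmx) unitmxE unitfE det2 !mxE /= !mulr1.
by rewrite eq_complex /= negb_and; apply/orP; right; rewrite opprK lt0r_neq0 ?addr_gt0.
Qed.

(** The eigenvalue at (z, 1) is l = c z + d; the other one is its conjugate, which
    is also its inverse since the determinant is 1. *)
Lemma stabilizes_torus (A : SL2 K) : stabilizes (val A) ->
  exists2 l, l != 0 & map_mx iota (val A) = ellP * torus l * ellP^-1.
Proof.
move=> [a b]; have := SL2_det A; rewrite det2 /= => dA.
move: a b dA => /=; set c : R := val A 1 0; set d : R := val A 1 1 => a b dA.
have [hc hd] : sval A 1 0 = c /\ sval A 1 1 = d by [].
clearbody c d.
pose l := ((c * x + d) +i* (c * t))%C : R[i].
pose l' := ((c * x + d) -i* (c * t))%C : R[i].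
have ll' : l * l' = 1.
  apply/eqP; rewrite eq_complex /= -dA a b; apply/andP.
  by split; apply/eqP; ring.
have l0 : l != 0 by apply: contra_eqN ll' => /eqP ->; rewrite mul0r eq_sym oner_eq0.
have lV : l^-1 = l' by apply: (mulfI l0); rewrite mulfV.
exists l => //; apply: (canRL (mulrK ellP_unit)).
apply/matrixP => i j; rewrite !mxE !sum_ord2 !mxE -/c -/d lV.
case: (ord2P i); case: (ord2P j); rewrite /= ?mulr1n ?mulr0n;
  apply/eqP; rewrite !(mulr0, mul1r, mulr1, addr0, add0r) eq_complex /= ?a ?b ?hc ?hd;
  by apply/andP; split; apply/eqP; ring.
Qed.

(** A zero entry means that A maps z or z^* to z or z^*. If A z = z or A z^* = z^*,
    then A is in the stabilizer. A real matrix of determinant 1 preserves the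
    upper half-plane and so cannot exchange z and z^*: the equations would
    give determinant - (d + c x)^2 - (c t)^2. *)
Lemma ellP_conj_neq0 (A : SL2 K) r c : ~ stabilizes (val A) ->
  (ellP^-1 * map_mx iota (val A) * ellP) r c != 0.
Proof.
move=> nA; have := SL2_det A; rewrite det2 => dA.
have rr' : r != (if r == 0 then 1 else 0) by case: (ord2P r).
apply/eqP => N0.
have [e /matrixP E] : exists e, map_mx iota (val A) *m col c ellP =
    e *: col (if r == 0 then 1 else 0) ellP.
  by eexists; apply: conj_entry0 N0; first exact: ellP_unit.
have := E 0 0; have {E} := E 1 0; rewrite !mxE !sum_ord2 !mxE /= {N0}.
move: nA dA; rewrite /stabilizes /=.
set al : R := sval A 0 0; set be : R := sval A 0 1.
set ga : R := sval A 1 0; set de : R := sval A 1 1.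
clearbody al be ga de => nA dA.
(* The signs s and s' choose between z and z^* in the source and in the
   target. *)
have key (s s' : R) : s ^+ 2 = 1 -> s' = s \/ s' = - s ->
    al%:C%C * (x +i* (s * t))%C + be%:C%C * 1 =
    (ga%:C%C * (x +i* (s * t))%C + de%:C%C * 1) * (x +i* (s' * t))%C -> False.
  move=> s2 ss' /eqP; rewrite eq_complex /= => /andP[/eqP re /eqP im].
  have st0 : s * t != 0.
    rewrite mulf_neq0 ?(lt0r_neq0 t0) //; apply: contra_eq_neq s2 => ->.
    by rewrite expr0n eq_sym oner_eq0.
  case: ss' => s'E; rewrite {}s'E in re im.
    have alE : al = 2 * ga * x + de.
      apply/eqP; rewrite -subr_eq0 -(mulIr_eq0 _ (mulIf st0)); apply/eqP; lra.
    have : al * x + be = (ga * x + de) * x - ga * (s ^+ 2 * t ^+ 2) by lra.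
    by rewrite s2 alE => re'; apply: nA; split=> //; lra.
  have alE : al = - de.
    apply/eqP; rewrite -subr_eq0 -(mulIr_eq0 _ (mulIf st0)); apply/eqP; lra.
  have beE : be = ga * (x ^+ 2 + t ^+ 2) + 2 * de * x.
    have : al * x + be = (ga * x + de) * x + ga * (s ^+ 2 * t ^+ 2) by lra.
    by rewrite s2 alE; lra.
  move: dA; rewrite alE beE.
  have := sqr_ge0 (de + ga * x); have := sqr_ge0 (ga * t); lra.
move=> e1; rewrite -[e]mulr1 -e1.
have sgE (b : bool) : (if b then (x +i* t)%C else (x -i* t)%C) =
    (x +i* ((-1) ^+ (~~ b) * t))%C.
  by case: b; rewrite /= ?expr0 ?expr1 ?mul1r ?mulN1r.
rewrite !sgE; apply: key; first by rewrite sqrr_sign.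
by do 2!case: eqP => _; rewrite /= ?expr0 ?expr1 ?opprK; [left|right|right|left].
Qed.

End Elliptic.

Lemma elliptic_case (R : realType) (k : nat) (g : 'I_k -> PSL2 (real_scalars R))
    (m : 'I_k -> int) (mu : set (PSL2 (real_scalars R))) (x t : R) :
  (0 < k)%N -> (forall i, m i != 0) ->
  (forall i, Fix mu `&` (PSL2_act (g i) @` Fix mu) = set0) -> 0 < t ->
  (forall nu, mu nu -> stabilizes x t (val (repr nu))) -> finite_and_proper g m mu.
Proof.
move=> k0 m0 hg t0 muS.
pose p : hpoint (real_scalars R) := Some (x, NngNum (ltW t0)).
have fixp : Fix mu p by move=> nu /muS; exact: stabilizes_act.
split=> [y|nell]; last first.
  by case: nell => nu mnu nu1; split=> //; exists p; split; [exact: t0 | exact: fixp].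
have gS i : ~ stabilizes x t (val (repr (g i))).
  move=> /(stabilizes_act t0) gp; suff: (Fix mu `&` (PSL2_act (g i) @` Fix mu)) p.
    by rewrite hg.
  by split=> //; exists p.
pose iota : {rmorphism real_scalars R -> R[i]} := real_complex R.
have G0 i r c : conj_coefs g iota (ellP x t) i r c != 0.
  exact: ellP_conj_neq0 (gS i).
apply: (finite_fibre (ellP_unit x t0) (@torus_unit _) (torus_grows k0 m0 G0)).
move=> nu /muS /(stabilizes_torus t0)[l l0 nuE].
by exists (repr nu), l; rewrite reprK; split.
Qed.

(** * Lifting an abelian group to commuting matrices *)

Section Commute.
Variable K : numFieldType.
Implicit Types (p q : PSL2 K) (A B : SL2 K) (X : 'M[K]_2).

Lemma eq_oppr_mx0 X : X = - X -> X = 0.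
Proof.
move=> /eqP; rewrite -subr_eq0 opprK -mulr2n => /eqP X2; apply/matrixP => i j.
have /matrixP/(_ i j)/eqP := X2.
by rewrite mulr2n !mxE -mulr2n mulrn_eq0 => /eqP.
Qed.

Lemma repr_commute p q : commute p q ->
  val (repr p) * val (repr q) = val (repr q) * val (repr p) :> 'M[K]_2 \/
  val (repr p) * val (repr q) = - (val (repr q) * val (repr p)) :> 'M[K]_2.
Proof.
rewrite /commute => pq; apply: (PSL2_eqP (repr p * repr q)%g (repr q * repr p)%g _).
by rewrite !PSL2_piM !reprK; apply/eqP.
Qed.

(** X is then conjugate to - X. *)
Lemma anticommute_tr0 A X : val A * X = - (X * val A) -> \tr X = 0.
Proof.
move=> AX; have {}AX : val A *m X = - (X *m val A) by exact: AX.
have : \tr (invmx (val A) *m (val A *m X)) = - \tr X.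
  rewrite AX mulmxN raddfN /= mxtrace_mulC -mulmxA.
  by rewrite mulmxV ?SL2_unit // mulmx1.
rewrite mulmxA mulVmx ?SL2_unit // mul1mx => /eqP.
by rewrite -subr_eq0 opprK -mulr2n mulrn_eq0 => /eqP.
Qed.

Lemma repr_neq1 p : p <> 1%g ->
  (val (repr p) : 'M[K]_2) != 1 /\ (val (repr p) : 'M[K]_2) != -1.
Proof.
move=> p1; split; apply/eqP => pE; apply: p1; rewrite -(reprK p);
  apply/eqP/PSL2_eqP; [by left | by right].
Qed.

Lemma tr0_sqr A : \tr (val A) = 0 -> val A * val A = -1 :> 'M[K]_2.
Proof. by move=> tA; rewrite Cayley_Hamilton2 tA SL2_det scale0r sub0r. Qed.

Lemma tr0_involution p : \tr (val (repr p)) = 0 -> (p * p)%g = 1%g.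
Proof.
move=> tp; have -> : (p * p)%g = \pi_(PSL2 K) (repr p * repr p)%g.
  by rewrite PSL2_piM reprK.
by apply/eqP/PSL2_eqP; right; exact: tr0_sqr.
Qed.

End Commute.

Section TraceZero.
Variables (K : numFieldType) (mu : set (PSL2 K)).
Hypothesis muA : is_abelian_subgroup mu.
Hypothesis mu0 : forall p, mu p -> p <> 1%g -> \tr (val (repr p)) = 0.
Let M (p : PSL2 K) : 'M[K]_2 := val (repr p).

Let mu_mul p q : mu p -> mu q -> mu (p * q)%g.
Proof.
move: muA => [[mu1 muV] _] mp mq; have := muV _ _ mp (muV _ _ mu1 mq).
by rewrite div1g /= invgK.
Qed.

Let mu_sqr p : mu p -> (p * p)%g = 1%g.
Proof.
by move=> mp; have [->|/(mu0 mp)/tr0_involution//] := pselect (p = 1%g); rewrite mulg1.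
Qed.

Let M_mul p q : M (p * q)%g = M p * M q \/ M (p * q)%g = - (M p * M q).
Proof.
have -> : (p * q)%g = \pi_(PSL2 K) (repr p * repr q)%g by rewrite PSL2_piM !reprK.
exact: PSL2_reprP.
Qed.

(** If p q were not trivial, then it would be traceless and its lift would have
    square -1 by Cayley-Hamilton; but the square of M p * M q is
    (-1) * (-1) = 1. *)
Lemma commuting_involutions_eq p q : mu p -> mu q -> p <> 1%g -> q <> 1%g ->
  M p * M q = M q * M p -> p = q.
Proof.
move=> mp mq p1 q1 pq; have [pq1|pq1] := pselect ((p * q)%g = 1%g).
  by rewrite -[p]mulg1 -(mu_sqr mq) mulgA pq1 mul1g.
have M2 r : mu r -> r <> 1%g -> M r * M r = -1 by move=> mr /(mu0 mr)/tr0_sqr.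
have : M (p * q)%g * M (p * q)%g = 1.
  have -> : M (p * q)%g * M (p * q)%g = M p * M q * (M p * M q).
    by case: (M_mul p q) => ->; rewrite ?mulrNN.
  by rewrite {2}pq mulrA -[_ * _ * M q]mulrA M2 // mulrN1 mulNr M2 // opprK.
rewrite M2 //; last exact: mu_mul.
by move=> /esym/eq_oppr_mx0/eqP; rewrite oner_eq0.
Qed.

(** If p and q are distinct and nontrivial, then the lift of any other nontrivial r
    anticommutes with M p and M q, hence commutes with M p * M q: so r = p q. *)
Lemma finite_trace_zero : finite_set mu.
Proof.
have [[p [mp p1]]|no_p] := pselect (exists p, mu p /\ p <> 1%g); last first.
  apply: sub_finite_set (finite_set1 1%g) => p mp.
  by apply: contrapT => p1; apply: no_p; exists p.
have [[q [mq [q1 qp]]]|no_q] :=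
    pselect (exists q, mu q /\ q <> 1%g /\ q <> p); last first.
  apply: (@sub_finite_set _ _ ([set 1%g] `|` [set p])).
    move=> q mq; apply: contrapT => /not_orP[q1 qp].
    by apply: no_q; exists q.
  by rewrite finite_setU; split; exact: finite_set1.
apply: (@sub_finite_set _ _ ([set 1%g; p; q] `|` [set (p * q)%g])); last first.
  by rewrite !finite_setU; do !split; exact: finite_set1.
move=> r mr; apply: contrapT => /not_orP[/not_orP[/not_orP[r1 rp] rq] rpq].
have anti s : mu s -> s <> 1%g -> r <> s -> M r * M s = - (M s * M r).
  move=> ms s1 rs; have [rsE|//] := repr_commute (muA.2 r s mr ms).
  by case: rs; apply: commuting_involutions_eq.
apply: rpq; apply: commuting_involutions_eq => //; first exact: mu_mul.
  move=> pq1; apply: qp.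
  by rewrite -[q]mul1g -(mu_sqr mp) -mulgA pq1 mulg1.
have E : M r * (M p * M q) = M p * M q * M r.
  rewrite mulrA (anti p) // mulNr -[M p * M r * M q]mulrA (anti q) //.
  by rewrite mulrN opprK mulrA.
by case: (M_mul p q) => ->; rewrite ?mulrN ?mulNr E.
Qed.

End TraceZero.

(** * The centralizer of a matrix of nonzero trace *)

Section Split.
Variables (R : realType) (K : scalars R) (mu : set (PSL2 K)) (A0 : 'M[K]_2).
Hypothesis detA0 : \det A0 = 1.
Hypothesis muC : forall nu, mu nu -> val (repr nu) * A0 = A0 * val (repr nu).

Let conj_det (P : 'M[K]_2) (A : SL2 K) :
  P \is a GRing.unit -> \det (P^-1 * val A * P) = 1.
Proof.
move=> uP; rewrite -!mulmxE !det_mulmx SL2_det mulr1 -det_mulmx.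
by rewrite [P^-1 *m P]mulVr // det1.
Qed.

Let conj_commute (P T : 'M[K]_2) nu : P \is a GRing.unit -> A0 * P = P * T -> mu nu ->
  P^-1 * val (repr nu) * P * T = T * (P^-1 * val (repr nu) * P).
Proof.
move=> uP AP /muC C.
have PA : P^-1 * A0 = T * P^-1.
  by apply: (mulIr uP); rewrite -mulrA AP mulKr // mulrVK.
by rewrite -mulrA -AP !mulrA -[P^-1 * _ * A0]mulrA C mulrA PA -!mulrA.
Qed.

Lemma torus_family (d : K) : d != 0 -> d ^+ 2 = \tr A0 ^+ 2 - 4 ->
  exists2 P : 'M[K]_2, P \is a GRing.unit &
    conj_family idfun P (fun t => t != 0) (@torus K) mu.
Proof.
move=> d0 /(torus_reduction detA0 d0)[P [l [uP l0 ll' AP]]]; exists P => // nu mnu.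
have [t t0 tE] := commute_torus l0 ll' (conj_det (repr nu) uP) (conj_commute uP AP mnu).
exists (repr nu), t; split=> //; first by rewrite reprK.
by rewrite map_mx_id // -tE !mulrA mulrV // mul1r mulrK.
Qed.

Lemma unip_family : \tr A0 ^+ 2 = 4 -> A0 != 1 -> A0 != -1 ->
  exists2 P : 'M[K]_2, P \is a GRing.unit & conj_family idfun P predT (@unip K) mu.
Proof.
move=> tA A1 AN1; have [P [l [uP AP]]] := unip_reduction detA0 tA A1 AN1.
exists P => // nu mnu; set N := P^-1 * val (repr nu) * P.
have NP : val (repr nu) = P * N * P^-1 by rewrite /N !mulrA mulrV // mul1r mulrK.
have NE : N * delta_mx 0 1 = delta_mx 0 1 * N.
  have := conj_commute uP AP mnu; rewrite -/N mulrDr mulrDl -!mulmxE.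
  by rewrite -scalar_mxC => /addrI.
have [s [sE|sE]] := commute_unip (conj_det (repr nu) uP) NE.
  by exists (repr nu), s; rewrite reprK map_mx_id // NP -sE.
(* The other lift of nu has eigenvalue 1. *)
exists (SL2_opp (repr nu)), s; split=> //.
  by rewrite -[LHS]reprK; apply/eqP/PSL2_eqP; right; rewrite /= opprK.
by rewrite map_mx_id //= NP [N]sE mulrN mulNr opprK.
Qed.

End Split.

(** The fixed point z = x + i t of A0 is the root of c z^2 + (d - a) z - b in the
    upper half-plane, of discriminant (a + d)^2 - 4 < 0. The equations that
    say that B commutes with A0 make (B_00 - B_11, B_01, B_10) proportional to
    (a - d, b, c), so B satisfies the same linear conditions. *)
Lemma elliptic_stabilizes (R : realType) (mu : set (PSL2 (real_scalars R)))
    (A0 : 'M[R]_2) :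
  \det A0 = 1 -> \tr A0 ^+ 2 < 4 ->
  (forall nu, mu nu -> (val (repr nu) : 'M[R]_2) * A0 = A0 * val (repr nu)) ->
  exists x t, 0 < t /\ forall nu, mu nu -> stabilizes x t (val (repr nu)).
Proof.
rewrite det2 tr2; set a := A0 0 0; set b := A0 0 1; set c := A0 1 0; set d := A0 1 1.
move=> dA tA muC.
have c0 : c != 0.
  apply/eqP => c0; move: tA; rewrite ltNge; apply/negP/negPn.
  have := sqr_ge0 (a - d); rewrite c0 in dA; nra.
have c2 : 0 < c ^+ 2 by rewrite exprn_even_gt0.
pose x := (a - d) / (2 * c); pose t := Num.sqrt ((4 - (a + d) ^+ 2) / (4 * c ^+ 2)).
have q0 : 0 < (4 - (a + d) ^+ 2) / (4 * c ^+ 2).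
  by rewrite divr_gt0 ?subr_gt0 // mulr_gt0.
exists x, t; split=> [|nu /muC /matrixP C]; first by rewrite sqrtr_gt0.
have := C 0 0; have := C 0 1; have {C} := C 1 0; rewrite !mxE !sum_ord2.
rewrite -/a -/b -/c -/d /stabilizes sqr_sqrtr; last exact: ltW.
move: (val (repr nu) : 'M[R]_2) => B h10 h01 h00.
have xE : 2 * x = (a - d) / c by rewrite /x; field.
have bE : b = - c * (x ^+ 2 + (4 - (a + d) ^+ 2) / (4 * c ^+ 2)).
  rewrite /x -[LHS](mulfK c0) (_ : b * c = a * d - 1); last lra.
  by field.
split.
  rewrite -mulrA [B 1 0 * x]mulrC mulrA xE; apply: (mulIf c0).
  rewrite mulrDl -[_ * B 1 0 * c]mulrA [B 1 0 * c]mulrC mulrA divfK //; lra.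
have Bb : B 0 1 * c = b * B 1 0 by lra.
by apply: (mulIf c0); rewrite Bb [in LHS]bE; ring.
Qed.

Theorem lemma3p7 (R : realType) (K : scalars R)
    (hK : K = real_scalars R \/ K = complex_scalars R)
    (mu : set (PSL2 K)) (hmu : is_maximal_abelian mu)
    (k : nat) (hk : (1 <= k)%N)
    (g : 'I_k -> PSL2 K) (m : 'I_k -> int)
    (hm : forall i, m i != 0)
    (hg : forall i, Fix mu `&` (PSL2_act (g i) @` Fix mu) = set0) :
  (forall x : K,
     finite_set [set nu | mu nu /\ PSL2_tr2 (phi g m nu) = x]) /\
  (~ purely_elliptic mu ->
     PSL2_abs_tr (phi g m nu) @[nu --> norm_to_oo mu] --> +oo).
Proof.
have muA := hmu.1.
have [[nu0 [mnu0 n1 tn0]]|no_nu0] := pselect (exists nu0,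
    [/\ mu nu0, nu0 <> 1%g & \tr (val (repr nu0)) <> 0]); last first.
  apply: finite_group_case; apply: finite_trace_zero muA _ => p mp p1.
  by apply: contrapT => tp; apply: no_nu0; exists p.
set A0 : 'M[K]_2 := val (repr nu0) in tn0.
have dA0 : \det A0 = 1 by exact: SL2_det.
have muC nu : mu nu -> val (repr nu) * A0 = A0 * val (repr nu).
  move=> mnu; have [//|AC] := repr_commute (muA.2 _ _ mnu mnu0).
  by case: tn0; exact: anticommute_tr0 AC.
have [A01 A0N1] := repr_neq1 n1.
have split_case (d : K) : d ^+ 2 = \tr A0 ^+ 2 - 4 -> finite_and_proper g m mu.
  have [->|d0] := eqVneq d 0; last first.
    by move=> /(torus_family dA0 muC d0)[P uP]; exact: torus_case.
  rewrite expr0n /= => /esym/eqP; rewrite subr_eq0 => /eqP tA.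
  by have [P uP] := unip_family dA0 muC tA A01 A0N1; exact: unip_case.
case: hK => EK; subst K; last exact: split_case (sqr_sqrtc _).
have [tA|tA] := leP (4 : R) (\tr A0 ^+ 2).
  by apply: (split_case (Num.sqrt (\tr A0 ^+ 2 - 4))); rewrite sqr_sqrtr // subr_ge0.
have [x [t [t0 muS]]] := elliptic_stabilizes dA0 tA muC.
exact: elliptic_case muS.
Qed.
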